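(* Let $X$ be a first countable Hausdorff space, let $x=(x_n)_{n\in\mathbf{N}}$ be a sequence taking values in $X$, and let $\mathcal{I}$ be an $F_\sigma$-ideal on $\mathbf{N}$. Then $\Lambda_x(\mathcal{I})=\Gamma_x(\mathcal{I})$. In particular, $\Lambda_x(\mathcal{I})$ is closed.
   Context: $\mathbf{N}$ denotes the positive integers. An ideal $\mathcal{I}$ on $\mathbf{N}$ is a collection of subsets of $\mathbf{N}$ closed under finite unions and subsets; it is assumed to contain the family $\mathrm{Fin}$ of finite subsets of $\mathbf{N}$ and to be different from $\mathcal{P}(\mathbf{N})$. Identifying subsets of $\mathbf{N}$ with their characteristic functions, $\mathcal{P}(\mathbf{N})$ carries the Cantor-space topology of $\{0,1\}^{\mathbf{N}}$; an $F_\sigma$-ideal is an ideal which is an $F_\sigma$-subset of this space. $\Lambda_x(\mathcal{I})$ (the $\mathcal{I}$-limit points of $x$) is the set of all $\ell\in X$ such that $\lim_{k\to\infty}x_{n_k}=\ell$ for some subsequence $(x_{n_k})$ with $\{n_k:k\in\mathbf{N}\}\notin\mathcal{I}$. $\Gamma_x(\mathcal{I})$ (the $\mathcal{I}$-cluster points of $x$) is the set of all $\ell\in X$ such that $\{n:x_n\in U\}\notin\mathcal{I}$ for every neighborhood $U$ of $\ell$. *)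

(* Defs.v *)
From mathcomp Require Import all_boot all_order.
From mathcomp Require Import all_classical topology sequences cantor borel_hierarchy.

Set Implicit Arguments.
Unset Strict Implicit.
Unset Printing Implicit Defensive.

Local Open Scope classical_set_scope.

(* Sequences are indexed by [nat], as everywhere in MathComp-Analysis; the
   positive integers are relabelled by the order isomorphism n |-> n.-1. *)

Record ideal (I : set (set nat)) : Prop := Ideal {
  idealU : forall A B, I A -> I B -> I (A `|` B);
  idealS : forall A B, A `<=` B -> I B -> I A;
  ideal_fin : forall A, finite_set A -> I A;
  ideal_proper : I <> setT
}.

(* The family [I], seen as a subset of {0,1}^N by identifying a set of
   integers with its characteristic function. *)
Definition indicators (I : set (set nat)) : set cantor_space :=
  [set c : cantor_space | I [set n | c n]].

Definition Fsigma_ideal (I : set (set nat)) : Prop :=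
  ideal I /\ Fsigma (indicators I).

Definition first_countable (X : topologicalType) : Prop :=
  forall p : X, exists2 B : set (set X), countable B &
    B `<=` nbhs p /\
    forall U, nbhs p U -> exists2 V, B V & V `<=` U.

Definition ideal_limit_points (X : topologicalType) (x : nat -> X)
    (I : set (set nat)) : set X :=
  [set l | exists n_ : nat -> nat,
    [/\ increasing_seq n_, ~ I (range n_) & x \o n_ @ \oo --> l]].

Definition ideal_cluster_points (X : topologicalType) (x : nat -> X)
    (I : set (set nat)) : set X :=
  [set l | forall U, nbhs l U -> ~ I [set n | U (x n)]].

(* Main.v *)
Require Import Defs.
From mathcomp Require Import all_boot all_order.
From mathcomp Require Import all_classical topology sequences cantor borel_hierarchy.

(** An F_sigma-ideal I, a union of closed sets F_n, is a P^+-ideal: if (A_n)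
    decreases outside I, then some B outside I is almost contained in every A_n.
    One builds B by finite approximation. Given B up to m_n, continue it by A_n;
    the result is not in I, hence not in F_n, and since F_n is closed this is
    already decided by an initial segment, say up to m_(n+1). The limit B
    avoids every F_n. For a cluster point l, take A_n to be the preimage of the
    n-th member of a decreasing countable neighbourhood base of l; the increasing
    enumeration of B then yields a subsequence converging to l. *)

Local Open Scope classical_set_scope.

(** Otherwise [F] would contain points agreeing with [c] on ever longer initial segments; these
    converge to [c] pointwise, which puts [c] in the closed set [F]. *)
Lemma closedC_cylinder (F : set cantor_space) (c : nat -> bool) :
  closed F -> ~ F c ->
  exists m, forall b : nat -> bool, (forall i, i < m -> b i = c i) -> ~ F b.
Proof.
move=> clF nFc; apply: contrapT => /forallNP H.
have /choice[b bP] : forall m, exists b : nat -> bool,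
    (forall i, i < m -> b i = c i) /\ F b.
  move=> m; have /existsNP[b /not_implyP[bc /contrapT Fb]] := H m.
  by exists b.
have bc : (b : nat -> cantor_space) @ \oo --> (c : cantor_space).
  apply/cvg_sup => N U [V] [[W] oW <-] WcN WU.
  apply: (filterS WU); rewrite nbhs_simpl; exists N.+1 => // k /= Nk.
  by rewrite /preimage/= (bP k).1.
apply: nFc; apply: (closed_cvg (V := cantor_space) _ clF _ _ bc).
by apply: nearW => m; exact: (bP m).2.
Qed.

Lemma Fsigma_ideal_pseudo_intersection (I : set (set nat))
    (A : nat -> set nat) :
  Fsigma_ideal I -> (forall n, A n.+1 `<=` A n) -> (forall n, ~ I (A n)) ->
  exists B (m : nat -> nat), ~ I B /\ forall n, B `\` `I_(m n) `<=` A n.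
Proof.
move=> [[IU IS Ifin _] [F clF IF]] decA nIA.
(* The pair [s] is a stage of the construction: only the bits of [s.1] below the length [s.2] are
   final. *)
pose splice n (s : (nat -> bool) * nat) (i : nat) :=
  if i < s.2 then s.1 i else `[< A n i >].
have /choice[next nextP] : forall ns : nat * ((nat -> bool) * nat),
    exists m, ns.2.2 < m /\ forall b : nat -> bool,
      (forall i, i < m -> b i = splice ns.1 ns.2 i) -> ~ F ns.1 b.
  move=> [n s] /=.
  have [|m mP] := closedC_cylinder (F n) (splice n s) (clF n).
    move=> Fs; apply: (nIA n).
    have Is : I [set i | splice n s i].
      by suff : indicators I (splice n s) by []; rewrite IF; exists n.
    (* The splice omits only finitely many elements of [A n], so it cannot lie in [I]. *)
    apply: (IS _ ([set i | splice n s i] `|` `I_s.2)).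
      move=> i Ai; have [lti|gei] := ltnP i s.2; first by right.
      by left; rewrite /splice/= ltnNge gei; exact/asboolP.
    exact: IU (Ifin _ (finite_II _)).
  (* The maximum makes the lengths strictly increasing, so that every bit eventually becomes
     final. *)
  exists (maxn m s.2.+1); split; first exact: leq_maxr.
  by move=> b bs; apply: mP => i im; apply: bs; rewrite leq_max im.
pose fix st n := if n isn't k.+1 then (fun=> false, 0)
  else (splice k (st k), next (k, st k)).
have st_lt n : (st n).2 < (st n.+1).2 by exact: (nextP (n, st n)).1.
have st_ge n : n <= (st n).2 by elim: n => // n /leq_ltn_trans; apply.
have st_le n k : n <= k -> (st n).2 <= (st k).2.
  elim: k => [|k IH]; first by rewrite leqn0 => /eqP->.
  rewrite leq_eqVlt => /predU1P[->//|/IH] /leq_trans; apply.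
  exact: ltnW.
have st_stable n k i : n <= k -> i < (st n).2 -> (st k).1 i = (st n).1 i.
  elim: k => [|k IH]; first by rewrite leqn0 => /eqP->.
  rewrite leq_eqVlt => /predU1P[->//|nk] im /=.
  by rewrite /splice (leq_trans im) ?IH// st_le.
(* Stage [i.+1] has length at least [i.+1], hence bit [i] is final there. *)
pose b i := (st i.+1).1 i.
have bE n i : i < (st n).2 -> b i = (st n).1 i.
  move=> im; have [le|/ltnW le] := leqP n i.+1; first exact: st_stable.
  by apply/esym/st_stable => //; exact: st_ge.
(* A bit finalised after stage [n] was copied from some [A j] with [n <= j], and [A j] is contained
   in [A n]. *)
have stA n k i : n <= k -> (st n).2 <= i -> i < (st k).2 -> (st k).1 i -> A n i.
  move=> nk ni; elim: k nk => [|k IH].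
    by rewrite leqn0 => /eqP->.
  rewrite leq_eqVlt => /predU1P[<-|nk]; first by rewrite ltnNge ni.
  move=> _ /=; rewrite /splice; case: ifPn => [ik|_ /asboolP]; first exact: IH.
  rewrite ltnS in nk; rewrite -(subnK nk).
  by elim: (k - n) => // j IHj /decA.
exists [set i | b i], (fun n => (st n).2); split.
  move=> Ib; have : indicators I b by [].
  rewrite IF => -[n _]; apply: (nextP (n, st n)).2 => i im.
  by rewrite (bE n.+1).
move=> n i [/= bi /negP]; rewrite -leqNgt => ni.
have im : i < (st (maxn n i.+1)).2.
  by apply: leq_trans (st_ge _); exact: leq_maxr.
by apply: (stA n _ i (leq_maxl _ _) ni im); rewrite -bE.
Qed.

Lemma first_countable_decreasing_base (X : topologicalType) (p : X) :
  first_countable X ->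
  exists U : nat -> set X, [/\ forall n, nbhs p (U n),
    forall n, U n.+1 `<=` U n &
    forall V, nbhs p V -> exists n, U n `<=` V].
Proof.
move=> /(_ p)[B cB [Bp Bbase]].
have [B0|[g]] := pfcard_geP cB.
  by have [V] := Bbase _ filterT; rewrite B0.
have gp n : nbhs p (g n) by apply: Bp; exact: funS.
(* Finite intersections along an enumeration of the base make it decreasing. *)
exists (fun n => [set y | forall i, i <= n -> g i y]); split.
- elim=> [|n IHn].
    by apply: filterS (gp 0) => y gy i; rewrite leqn0 => /eqP->.
  apply: filterS2 IHn (gp n.+1) => y yn yn1 i.
  by rewrite leq_eqVlt => /predU1P[->//|/yn].
- by move=> n y yn i /leqW/yn.
- move=> V /Bbase[W BW WV]; have [n _ gn] := 'surj_g BW.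
  by exists n => y yn; apply: WV; rewrite -gn; exact: yn.
Qed.

Lemma increasing_enumeration (B : set nat) : infinite_set B ->
  exists2 f : nat -> nat, increasing_seq f & range f = B.
Proof.
move=> Binf.
have /choice[next nextP] : forall n, exists k,
    [/\ n <= k, B k & forall j, n <= j -> B j -> k <= j].
  move=> n; have exB : exists k, (n <= k) && `[< B k >].
    have /infinite_setN0[k [Bk /negP]] := infinite_setD Binf (finite_II n).
    by rewrite -leqNgt => nk; exists k; rewrite nk; exact/asboolP.
  case: (ex_minnP exB) => k /andP[nk /asboolP Bk] kmin.
  by exists k; split=> // j nj Bj; apply: kmin; rewrite nj; exact/asboolP.
pose fix f n := if n isn't k.+1 then next 0 else next (f k).+1.
have f_lt n : f n < f n.+1 by have [] := nextP (f n).+1.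
have f_ge n : n <= f n by elim: n => // n /leq_ltn_trans; apply.
exists f; first exact/increasing_seqP.
apply/seteqP; split=> [_ [[|k] _ <-]|b Bb].
- by have [] := nextP 0.
- by have [] := nextP (f k).+1.
have [n] : exists n, b < f n by exists b.+1; exact: f_ge.
(* Descend from a value of [f] above [b]: by minimality of [next], no element of [B] lies before
   [f 0] or strictly between consecutive values. *)
elim: n => [|k IH] /=.
  by have [_ _ /(_ b (leq0n _) Bb) le] := nextP 0; rewrite ltnNge le.
have [kb|] := ltnP (f k) b.
  by have [_ _ /(_ b kb Bb) le] := nextP (f k).+1; rewrite ltnNge le.
by rewrite leq_eqVlt => /predU1P[-> _|/IH + _]; [exists k|].
Qed.

(** All but finitely many indices of the subsequence fall in the preimage of a given neighbourhood,
    so that preimage cannot be in [I]. *)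
Lemma limit_sub_cluster_points (X : topologicalType) (x : nat -> X)
    (I : set (set nat)) :
  ideal I -> ideal_limit_points x I `<=` ideal_cluster_points x I.
Proof.
move=> [IU IS Ifin _] l [n_ [_ nI xl]] U Ul IUx; apply: nI.
have [N _ NU] := xl _ Ul.
apply: (IS _ ([set n | U (x n)] `|` n_ @` `I_N)).
  move=> _ [k _ <-]; have [kN|Nk] := ltnP k N; first by right; exists k.
  by left; exact: NU.
by apply: IU => //; apply/Ifin/finite_image/finite_II.
Qed.

Lemma cluster_sub_limit_points (X : topologicalType) (x : nat -> X)
    (I : set (set nat)) : first_countable X -> Fsigma_ideal I ->
  ideal_cluster_points x I `<=` ideal_limit_points x I.
Proof.
move=> X1 FI l clust.
have [U [Ul decU baseU]] := first_countable_decreasing_base X l X1.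
have [B [m [nIB BA]]] := Fsigma_ideal_pseudo_intersection I
  (fun n => [set k | U n (x k)]) FI (fun n k => decU n (x k))
  (fun n => clust _ (Ul n)).
have Binf : infinite_set B by move=> /(ideal_fin FI.1).
have [f fincr fB] := increasing_enumeration B Binf.
exists f; split; rewrite ?fB//.
have f_ge n : n <= f n.
  elim: n => // n /leq_ltn_trans; apply.
  by move/increasing_seqP : fincr; exact.
(* Since [k <= f k], the threshold [m n] for elements of [B] also serves as a threshold for the
   index [k]. *)
move=> V /baseU[n UV]; exists (m n) => // k /= mk; apply/UV/BA; split.
  by rewrite -fB; exists k.
by apply/negP; rewrite -leqNgt (leq_trans mk).
Qed.

Lemma closed_ideal_cluster_points (X : topologicalType) (x : nat -> X)
    (I : set (set nat)) : closed (ideal_cluster_points x I).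
Proof.
(* The interior of [U] meets the set in a cluster point [l'], of which [U] is again a
   neighbourhood. *)
move=> l cl U /nbhs_interior /cl[l' [cl' /cl']].
exact.
Qed.

Theorem theorem2p3 (X : topologicalType) (hX1 : first_countable X)
    (hX2 : hausdorff_space X) (x : nat -> X) (I : set (set nat))
    (hI : Fsigma_ideal I) :
  ideal_limit_points x I = ideal_cluster_points x I /\
  closed (ideal_limit_points x I).
Proof.
have -> : ideal_limit_points x I = ideal_cluster_points x I.
  apply/seteqP; split; first exact: limit_sub_cluster_points hI.1.
  exact: cluster_sub_limit_points.
by split=> //; exact: closed_ideal_cluster_points.
Qed.
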